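(* Let $f:\mathbb{R}\to\mathbb{R}$ be real analytic and let $\mathcal{M}_f=(\mathbb{R}^4,g_f)$, where, in coordinates $(x,y,\tilde x,\tilde y)$, the non-zero components (up to symmetry) of $g_f$ are $g_f(\partial_x,\partial_x)=-2f(y)$ and $g_f(\partial_x,\partial_{\tilde x})=g_f(\partial_y,\partial_{\tilde y})=1$. Then: (1) $\mathcal{M}_f$ is symmetric if and only if $f^{(3)}\equiv0$. (2) $\mathcal{M}_f$ is homogeneous if and only if there exist $a,\lambda\in\mathbb{R}$ such that $f^{(2)}(y)=ae^{\lambda y}$ for all $y\in\mathbb{R}$.
   Context: $f^{(j)}$ denotes the $j$-th derivative of $f$. A pseudo-Riemannian manifold is (locally) symmetric if $\nabla R=0$, where $R$ is its curvature tensor and $\nabla$ its Levi-Civita connection; for the complete simply connected manifolds $\mathcal{M}_f$ this is what ''symmetric'' means. A pseudo-Riemannian manifold is homogeneous if its isometry group acts transitively on it. *)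

(* Defs.v *)
From HB Require Import structures.
From mathcomp Require Import all_boot all_order all_algebra.
From mathcomp Require Import all_classical all_reals all_analysis.
From mathcomp Require Import ring.
Set Implicit Arguments.
Unset Strict Implicit.
Unset Printing Implicit Defensive.
Import Order.TTheory GRing.Theory Num.Theory.
Import numFieldNormedType.Exports.
Local Open Scope ring_scope.
Local Open Scope classical_set_scope.

(* Tensor calculus on R^n with its global chart.  Points and tangent vectors
   are row vectors; the frame field d/dx_i is the constant vector delta_mx 0 i. *)

Definition real_analytic (R : realType) (f : R -> R) : Prop :=
  forall y0 : R, exists c : nat -> R, exists2 r : R, 0 < r &
    forall y : R, `|y - y0| < r -> pseries c (y - y0) @ \oo --> f y.

Definition partial (R : realType) (n : nat) (W : normedModType R) (i : 'I_n)
    (h : 'rV[R]_n -> W) : 'rV[R]_n -> W :=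
  fun p => 'D_(delta_mx 0 i) h p.

Fixpoint of_class (R : realType) (n : nat) (W : normedModType R) (k : nat)
    (h : 'rV[R]_n -> W) : Prop :=
  match k with
  | 0 => continuous h
  | k'.+1 => (forall p, differentiable h p) /\
             (forall i : 'I_n, of_class k' (partial i h))
  end.

Definition smooth (R : realType) (n : nat) (W : normedModType R)
    (h : 'rV[R]_n -> W) : Prop :=
  forall k, of_class k h.

(* [g p i j] is g_p(d/dx_i, d/dx_j). *)
Definition metric (R : realType) (n : nat) := 'rV[R]_n -> 'M[R]_n.

Definition metric_form (R : realType) (n : nat) (g : metric R n)
    (p u v : 'rV[R]_n) : R :=
  (u *m g p *m v^T) 0 0.

(* [christoffel g k i j p] is Gamma^k_ij at p, i.e. the Levi-Civita connection
   is nabla_{d_i} d_j = Gamma^k_ij d_k; see [christoffel_torsion_free] and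
   [christoffel_metric]. *)
Definition christoffel (R : realType) (n : nat) (g : metric R n)
    (k i j : 'I_n) (p : 'rV[R]_n) : R :=
  2^-1 * \sum_(l < n) invmx (g p) k l *
    (partial i (fun q => g q j l) p + partial j (fun q => g q i l) p
     - partial l (fun q => g q i j) p).

(* [curvature g l i j k] is R_ijk^l, where
   R(d_i, d_j) d_k = nabla_{d_i} nabla_{d_j} d_k - nabla_{d_j} nabla_{d_i} d_k
                   = R_ijk^l d_l. *)
Definition curvature (R : realType) (n : nat) (g : metric R n)
    (l i j k : 'I_n) (p : 'rV[R]_n) : R :=
  partial i (christoffel g l j k) p - partial j (christoffel g l i k) p
  + \sum_(s < n) (christoffel g l i s p * christoffel g s j k p
                  - christoffel g l j s p * christoffel g s i k p).

(* [nabla_curvature g m l i j k] is nabla_m R_ijk^l, the d_l-component of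
   (nabla_{d_m} R)(d_i, d_j) d_k. *)
Definition nabla_curvature (R : realType) (n : nat) (g : metric R n)
    (m l i j k : 'I_n) (p : 'rV[R]_n) : R :=
  partial m (curvature g l i j k) p
  + \sum_(s < n) (christoffel g l m s p * curvature g s i j k p
                  - christoffel g s m i p * curvature g l s j k p
                  - christoffel g s m j p * curvature g l i s k p
                  - christoffel g s m k p * curvature g l i j s p).

Definition symmetric_manifold (R : realType) (n : nat) (g : metric R n) : Prop :=
  forall (m l i j k : 'I_n) (p : 'rV[R]_n), nabla_curvature g m l i j k p = 0.

Definition diffeomorphism (R : realType) (n : nat)
    (phi : 'rV[R]_n -> 'rV[R]_n) : Prop :=
  smooth phi /\
  exists psi : 'rV[R]_n -> 'rV[R]_n,
    [/\ smooth psi, cancel phi psi & cancel psi phi].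

Definition is_isometry (R : realType) (n : nat) (g : metric R n)
    (phi : 'rV[R]_n -> 'rV[R]_n) : Prop :=
  diffeomorphism phi /\
  forall p u v : 'rV[R]_n,
    metric_form g (phi p) ('d phi p u) ('d phi p v) = metric_form g p u v.

Definition homogeneous_manifold (R : realType) (n : nat) (g : metric R n) : Prop :=
  forall p q : 'rV[R]_n, exists2 phi, is_isometry g phi & phi p = q.

(* The coordinates (x, y, x~, y~) have indices 0, 1, 2, 3. *)
Definition metric_f (R : realType) (f : R -> R) : metric R 4 :=
  fun p => (- 2 * f (p 0 1)) *: delta_mx 0 0
    + delta_mx 0 2 + delta_mx 2 0 + delta_mx 1 3 + delta_mx 3 1.

Lemma metric_f_sym (R : realType) (f : R -> R) p : (metric_f f p)^T = metric_f f p.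
Proof.
apply/matrixP => i j; rewrite !mxE.
by case: i => [[|[|[|[|i]]]] ?] //; case: j => [[|[|[|[|j]]]] ?] //;
   rewrite /=; ring.
Qed.

Lemma metric_f_unit (R : realType) (f : R -> R) p : metric_f f p \in unitmx.
Proof.
pose h : 'M[R]_4 := (2 * f (p 0 1)) *: delta_mx 2 2
    + delta_mx 0 2 + delta_mx 2 0 + delta_mx 1 3 + delta_mx 3 1.
suff /mulmx1_unit[] : metric_f f p *m h = 1%:M by [].
apply/matrixP => i j; rewrite !mxE !big_ord_recl big_ord0 !mxE /=.
by case: i => [[|[|[|[|i]]]] ?] //; case: j => [[|[|[|[|j]]]] ?] //;
   rewrite /=; ring.
Qed.

(* The connection given by [christoffel] is torsion-free and metric. *)
Lemma christoffel_torsion_free (R : realType) (n : nat) (g : metric R n)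
    (k i j : 'I_n) (p : 'rV[R]_n) :
  (forall q, (g q)^T = g q) -> christoffel g k i j p = christoffel g k j i p.
Proof.
move=> gT; rewrite /christoffel; congr (_ * _); apply: eq_bigr => l _.
have -> : (fun q => g q i j) = (fun q => g q j i).
  by apply/funext => q; rewrite -[in LHS]gT mxE.
by congr (_ * _); ring.
Qed.

Lemma christoffel_metric (R : realType) (n : nat) (g : metric R n)
    (k i j : 'I_n) (p : 'rV[R]_n) :
  (forall q, (g q)^T = g q) -> g p \in unitmx ->
  partial k (fun q => g q i j) p =
    \sum_(l < n) (christoffel g l k i p * g p l j + christoffel g l k j p * g p i l).
Proof.
move=> gT gU.
have gC a b : (fun q => g q a b) = (fun q => g q b a).
  by apply/funext => q; rewrite -[in LHS]gT mxE.
have lower a b c : \sum_(l < n) christoffel g l a b p * g p l c =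
    2^-1 * (partial a (fun q => g q b c) p + partial b (fun q => g q a c) p
     - partial c (fun q => g q a b) p).
  pose w : 'cV[R]_n := \col_l (partial a (fun q => g q b l) p +
     partial b (fun q => g q a l) p - partial l (fun q => g q a b) p).
  have := congr1 (fun M : 'cV_n => 2^-1 * M c 0) (mulKVmx gU w).
  rewrite /= [w c 0]mxE => <-; rewrite mxE mulr_sumr; apply: eq_bigr => l _.
  rewrite /christoffel -[in LHS]mulrA; congr (_ * _).
  rewrite mulrC -[in RHS](gT p) [(g p)^T c l]mxE; congr (_ * _).
  by rewrite gT mxE; apply: eq_bigr => m _; rewrite [w m 0]mxE.
rewrite big_split /= lower.
have -> : \sum_(l < n) christoffel g l k j p * g p i l =
          \sum_(l < n) christoffel g l k j p * g p l i.
  by apply: eq_bigr => l _; rewrite (congr1 (fun h => h p) (gC i l)).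
by rewrite lower (gC j i) (gC k i) (gC k j); field.
Qed.

(* Main.v *)
(* The only Christoffel symbols of [metric_f f] are [f' y] (up to sign), so nabla R has
   the single coefficient [f''' y]; this gives (1).

   An isometry phi = (X, Y, Z, W) carries the Levi-Civita connection to itself.  For X
   and Y this is a linear second order system whose integrability conditions force X and
   Y to be affine functions of (x, y) alone, unless f'' vanishes identically.  The
   integrability conditions for Z and W then become f''(y) = D^2 f''(Y), D being the
   Jacobian determinant of (X, Y) with respect to (x, y).  If the isometries act
   transitively, h = f'' is therefore a constant or satisfies h h'' = m h'^2 with h and
   h' nowhere zero, and the latter is possible on the whole line only for m = 1, when h
   is an exponential.  Conversely, if f'' = a e^(lambda y), then
   f(y + s) e^(-lambda s) - f(y) is affine in y, so that (x, y) -> (mu x, y + s) with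
   mu = e^(-lambda s / 2) lifts to an isometry with quadratic Z and W. *)
Require Import Defs.
From mathcomp Require Import all_boot all_order all_algebra.
From mathcomp Require Import all_classical all_reals all_analysis.
From mathcomp Require Import ring lra.
Import Order.TTheory GRing.Theory Num.Theory.
Import numFieldNormedType.Exports.
Local Open Scope ring_scope.
Local Open Scope classical_set_scope.

Set Implicit Arguments.
Unset Strict Implicit.
Unset Printing Implicit Defensive.

(** * Power series and derivatives of real analytic functions *)

(** The factor n+1 is absorbed by a larger radius: for |x| < z < |K|, factoring z^(n+1) - |x|^(n+1)
    gives (n+1) |x|^n (z - |x|) <= z^(n+1). The series is thus dominated by a multiple of the one
    with terms |c_(n+1)| z^(n+1), which converges because z lies inside the disc. *)
Lemma is_cvg_pseries_diffs (R : realType) (c : R^nat) (K x : R) :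
  cvgn (pseries c K) -> `|x| < `|K| -> cvgn (pseries (pseries_diffs c) x).
Proof.
move=> cK xK; pose z := (`|x| + `|K|) / 2.
have xz : `|x| < z by rewrite /z; lra.
have zK : `|z| < `|K| by rewrite ger0_norm /z; have := normr_ge0 x; lra.
have z0 : 0 <= z by apply: le_trans (ltW xz).
have cz := is_cvg_pseries_inside_norm cK zK.
have pow n : n.+1%:R * `|x| ^+ n * (z - `|x|) <= z ^+ n.+1.
  apply: (@le_trans _ _ (z ^+ n.+1 - `|x| ^+ n.+1)); last first.
    by rewrite gerBl exprn_ge0.
  rewrite subrXX mulrC ler_wpM2l ?subr_ge0 ?(ltW xz)//.
  rewrite mulr_natl -[X in _ *+ X]card_ord -sumr_const; apply: ler_sum => i _ /=.
  have ile : (i <= n)%N by rewrite -ltnS.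
  rewrite -[in leLHS](subnK ile) exprD.
  by rewrite ler_wpM2r ?exprn_ge0// lerXn2r ?nnegrE// ltW.
apply: normed_cvg; rewrite /normed_series_of /=.
apply: (@series_le_cvg _ _ (fun n => (z - `|x|)^-1 * (`|c n.+1| * z ^+ n.+1))).
- by move=> n.
- by move=> n; rewrite mulr_ge0 ?invr_ge0 ?subr_ge0 ?(ltW xz)// mulr_ge0 ?exprn_ge0.
- move=> n /=; rewrite /pseries_diffs ler_pdivlMl ?subr_gt0//.
  rewrite !normrM normrX normr_nat.
  have := ler_wpM2l (normr_ge0 (c n.+1)) (pow n).
  by apply: le_trans; rewrite le_eqVlt; apply/orP; left; apply/eqP; ring.
apply: is_cvg_seriesZ.
have E : series (fun n => `|c n.+1| * z ^+ n.+1) =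
    (fun n => pseries (fun i => `|c i|) z n.+1 - `|c 0%N|).
  apply/funext => n; rewrite /pseries /series /= [in RHS]big_nat_recl//=.
  by rewrite expr0 mulr1 addrAC subrr add0r.
rewrite E; apply: is_cvgB; last exact: is_cvg_cst.
by have /cvg_ex[l cl] := cz; apply/cvg_ex; exists l; rewrite cvg_shiftS.
Qed.

(** A local expansion is differentiated term by term without loss of radius, so the lemma can be
    iterated to reach derivatives of any order. *)
Lemma real_analytic_derive (R : realType) (f : R -> R) : real_analytic f ->
  (forall y, derivable f y 1) /\ real_analytic f^`().
Proof.
move=> fa.
suff H y0 : exists c : R^nat, exists2 r : R, 0 < r & forall y, `|y - y0| < r ->
    derivable f y 1 /\ pseries (pseries_diffs c) (y - y0) @ \oo --> f^`() y.
  split=> [y|y0].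
    have [c [r r0 /(_ y)[]//]] := H y; by rewrite subrr normr0.
  have [c [r r0 cr]] := H y0.
  by exists (pseries_diffs c), r => // y /cr[].
have [c [r r0 cr]] := fa y0.
exists c, r => // y yr.
(* Termwise differentiation at [y] asks for convergence at [K1] of the series and of its first two
   formal derivatives. Each formal derivative costs a slightly smaller radius, hence three radii
   between |y - y0| and [r]. *)
pose K1 := (`|y - y0| + r) / 2.
pose K2 := (K1 + r) / 2.
pose K3 := (K2 + r) / 2.
have y0' : 0 <= `|y - y0| by [].
have K10 : `|y - y0| < `|K1| by rewrite (@ger0_norm _ K1) /K1; lra.
have K12 : `|K1| < `|K2| by rewrite !ger0_norm /K2 /K1; lra.
have K23 : `|K2| < `|K3| by rewrite !ger0_norm /K3 /K2 /K1; lra.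
have K3r : `|K3| < r by rewrite !ger0_norm /K3 /K2 /K1; lra.
have c3 : cvgn (pseries c K3).
  by apply/cvg_ex; exists (f (K3 + y0)); rewrite -{1}(addrK y0 K3); apply: cr; rewrite addrK.
have d2 := is_cvg_pseries_diffs c3 K23.
have d1 := is_cvg_pseries_diffs d2 K12.
have dd1 : cvgn (pseries c K1).
  by apply: is_cvg_pseries_inside c3 _; apply: lt_trans K23.
have cd1 : cvgn (pseries (pseries_diffs c) K1) by apply: is_cvg_pseries_inside d2 _.
have := pseries_snd_diffs dd1 cd1 d1 K10.
set L := limn _ => HL.
have Hf : is_derive y (1 : R) f L.
  have H2 : is_derive y (1 : R) ((fun x => limn (pseries c x)) \o (fun x => x - y0)) L.
    have -> : L = L *: (1 - 0) by rewrite subr0; exact/esym/mulr1.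
    exact: is_derive1_comp.
  apply: near_eq_is_derive H2.
  near=> x; rewrite /=; apply/cvg_lim => //; apply: cr.
  near: x; have : 0 < r - `|y - y0| by rewrite subr_gt0.
  move=> e0; exists (r - `|y - y0|) => // x /=.
  move=> H; rewrite distrC.
  have -> : y0 - x = (y - x) - (y - y0) by ring.
  by apply: le_lt_trans (ler_normB _ _) _; rewrite -ltrBrDr.
split; first exact: ex_derive.
rewrite derive1E derive_val.
exact: (is_cvg_pseries_inside cd1 K10).
Unshelve. all: by end_near.
Qed.

(** * Mean value theorem along lines and symmetry of mixed derivatives *)

(** The two difference quotients are the same function of the increment; this makes one-variable
    theorems available for directional derivatives. *)
Lemma is_derive_line (R : realType) (V : normedModType R) (h : V -> R) (p v : V)
  (t : R) : derivable h (p + t *: v) v ->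
  is_derive t (1 : R) (fun s => h (p + s *: v)) ('D_v h (p + t *: v)).
Proof.
move=> hd.
have E : (fun s : R => s^-1 *: (((fun s => h (p + s *: v)) \o shift t) (s *: (1 : R)) - h (p + t *: v)))
   = (fun s : R => s^-1 *: ((h \o shift (p + t *: v)) (s *: v) - h (p + t *: v))).
  apply/funext => s /=; congr (_ *: (h _ - _)).
  by rewrite [s *: 1]mulr1 scalerDl addrCA.
split; first by rewrite /derivable E.
by rewrite /derive E.
Qed.

Lemma MVT_line (R : realType) (V : normedModType R) (h : V -> R) (p v : V) (t : R) :
  0 < t -> (forall q, derivable h q v) ->
  exists2 s : R, 0 < s < t & h (p + t *: v) - h p = t * 'D_v h (p + s *: v).
Proof.
move=> t0 hd.
have dl s : is_derive s (1 : R) (fun s => h (p + s *: v)) ('D_v h (p + s *: v)).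
  exact: is_derive_line.
have cl : {within `[0, t], continuous (fun s : R => h (p + s *: v))}.
  apply: continuous_subspaceT => x; apply: differentiable_continuous.
  by apply/derivable1_diffP; apply: ex_derive.
have [s] := MVT t0 (fun x _ => dl x) cl.
rewrite in_itv /= => st; rewrite scale0r addr0 subr0 mulrC => ->.
by exists s.
Qed.

(** The mean value theorem is used twice: along [a] for x -> h(x + t b) - h(x), then along [b] for
    ['D_a h]. *)
Lemma second_difference (R : realType) (V : normedModType R) (h : V -> R)
    (a b p : V) (t : R) : 0 < t ->
  (forall q, derivable h q a) -> (forall q, derivable ('D_a h) q b) ->
  exists r s : R, [/\ 0 < r < t, 0 < s < t &
    h (p + t *: a + t *: b) - h (p + t *: a) - (h (p + t *: b) - h p) =
    t * t * 'D_b ('D_a h) (p + r *: a + s *: b)].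
Proof.
move=> t0 ha hab.
have sh q : is_derive q a (fun x => h (x + t *: b)) ('D_a h (q + t *: b)).
  have E : (fun s : R => s^-1 *: (((fun x => h (x + t *: b)) \o shift q) (s *: a) - h (q + t *: b)))
    = (fun s : R => s^-1 *: ((h \o shift (q + t *: b)) (s *: a) - h (q + t *: b))).
    by apply/funext => s /=; rewrite addrA.
  by split; rewrite /derivable /derive E//; exact: ha.
have shB q := is_deriveB (sh q) (derivableP (ha q)).
have [r rt] := MVT_line p t0 (fun q => @ex_derive _ _ _ _ _ _ _ (shB q)).
rewrite (@derive_val _ _ _ _ _ _ _ (shB _)) => H.
have [s st H2] := MVT_line (p + r *: a) t0 hab.
exists r, s; split=> //.
by rewrite -mulrA -H2 -H.
Qed.

(** Both sample points lie in a parallelogram that shrinks to [p] with [t], so continuity carries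
    the equality to [p]. The directions appear in opposite orders to match the two expansions of a
    second difference. *)
Lemma continuous_eq_of_arbitrarily_close (R : realType) (V : normedModType R)
    (A B : V -> R) (u v p : V) :
  {for p, continuous A} -> {for p, continuous B} ->
  (forall t : R, 0 < t -> exists r s r' s' : R,
    [/\ 0 < r < t, 0 < s < t, 0 < r' < t, 0 < s' < t &
     A (p + r *: u + s *: v) = B (p + r' *: v + s' *: u)]) ->
  A p = B p.
Proof.
move=> cA cB key.
apply/eqP; rewrite -subr_eq0 -normr_le0; apply/ler_addgt0Pl => e e0; rewrite addr0.
have e2 : 0 < e / 2 by rewrite divr_gt0.
move/cvgrPdist_lt/(_ _ e2)/nbhs_ballP : cA => [d1 /= d10 H1].
move/cvgrPdist_lt/(_ _ e2)/nbhs_ballP : cB => [d2 /= d20 H2].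
(* For t = d / N the sample points are within t (N - 1) = d - t of [p]. The summand 1 in [N] makes
   the bound strict and keeps [N] positive when u = v = 0. *)
pose d := Num.min d1 d2; pose N := `|u| + `|v| + 1.
have d0 : 0 < d by rewrite lt_min d10.
have N0 : 0 < N by rewrite /N ltr_wpDl// addr_ge0.
pose t := d / N.
have t0 : 0 < t by rewrite divr_gt0.
have near_p (a b : V) (r s : R) : `|a| + `|b| + 1 = N -> 0 < r < t -> 0 < s < t ->
    `|p - (p + r *: a + s *: b)| < d.
  move=> NE /andP[r0 rt] /andP[s0 st].
  rewrite -addrA opprD addrA subrr sub0r normrN.
  apply: (@le_lt_trans _ _ (t * (`|a| + `|b|))).
    rewrite (le_trans (ler_normD _ _))// !normrZ mulrDr (gtr0_norm r0) (gtr0_norm s0).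
    by rewrite lerD// ler_wpM2r// ltW.
  have -> : `|a| + `|b| = N - 1 by rewrite -NE addrK.
  by rewrite mulrBr mulr1 /t divfK ?gt_eqF// ltrBlDr ltrDl.
have {}H1 q : `|p - q| < d -> `|A p - A q| < e / 2.
  by move=> pq; apply: H1; rewrite -ball_normE /ball_ /= (lt_le_trans pq)// ge_min lexx.
have {}H2 q : `|p - q| < d -> `|B p - B q| < e / 2.
  by move=> pq; apply: H2; rewrite -ball_normE /ball_ /= (lt_le_trans pq)// ge_min lexx orbT.
have [r [s [r' [s' [rt st rt' st' E]]]]] := key t t0.
have B1 := H1 _ (near_p u v r s erefl rt st).
have B2 := H2 _ (near_p v u r' s' (congr1 (+%R^~ 1) (addrC _ _)) rt' st').
rewrite E in B1; rewrite -(subrKA (B (p + r' *: v + s' *: u))) -[X in _ + X]opprB.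
by rewrite (le_trans (ler_normB _ _))// [e]splitr lerD// ltW.
Qed.

(* Symmetry of mixed derivatives: by the mean value theorem, the second difference
   of [h] over a small parallelogram is [t * t] times either mixed derivative at
   some point nearby. *)
Lemma derive_comm (R : realType) (V : normedModType R) (h : V -> R) (u v p : V) :
  (forall q, derivable h q u) -> (forall q, derivable h q v) ->
  (forall q, derivable ('D_u h) q v) -> (forall q, derivable ('D_v h) q u) ->
  {for p, continuous ('D_v ('D_u h))} -> {for p, continuous ('D_u ('D_v h))} ->
  'D_v ('D_u h) p = 'D_u ('D_v h) p.
Proof.
move=> hu hv huv hvu cA cB.
apply: (@continuous_eq_of_arbitrarily_close _ _ _ _ u v p cA cB) => t t0.
have [r [s [rt st E1]]] := second_difference p t0 hu huv.
have [r' [s' [rt' st' E2]]] := second_difference p t0 hv hvu.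
exists r, s, r', s'; split; [exact: rt|exact: st|exact: rt'|exact: st'|].
move: E1 E2; rewrite [p + t *: v + _]addrAC.
move: ('D_v ('D_u h) (p + _ + _)) ('D_u ('D_v h) (p + _ + _)) => x y.
move: (h (p + t *: u + t *: v)) (h (p + t *: u)) (h (p + t *: v)) (h p) => a b c d E1 E2.
have E : t * t * x = t * t * y.
  by apply: etrans (esym E1) _; apply: etrans _ E2; ring.
by apply: (@mulfI R (t * t)); [rewrite mulf_neq0 ?lt0r_neq0|exact: E].
Qed.

(** * Calculus of functions of class C^k in coordinates *)

Lemma is_derive_coord (R : realType) (n : nat) (a : 'I_n) (p v : 'rV[R]_n) :
  is_derive p v (fun q : 'rV[R]_n => q 0 a) (v 0 a).
Proof.
split; first by apply: diff_derivable; exact: differentiable_coord.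
have := derive_mx (@derivable_id _ _ p v); rewrite derive_id => /matrixP/(_ 0 a).
by rewrite mxE => ->.
Qed.

Lemma is_derive_comp (R : realType) (V : normedModType R) (f : R -> R) (h : V -> R)
  (p v : V) (df dh : R) :
  is_derive (h p) (1 : R) f df -> differentiable h p -> is_derive p v h dh ->
  is_derive p v (fun q => f (h q)) (df * dh).
Proof.
move=> [fd fE] hd [_ hE]; have {}fd : differentiable f (h p) by exact/derivable1_diffP.
have fhd : differentiable (f \o h) p by exact: differentiable_comp.
split; first exact: diff_derivable.
rewrite -[LHS]/('D_v (f \o h) p) deriveE// diff_comp//= -(deriveE _ hd) hE.
by rewrite deriv1E ?derive1E ?fE 1?mulrC//; exact/derivable1_diffP.
Qed.

Lemma of_classW (R : realType) (n : nat) (W : normedModType R) (k : nat)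
  (h : 'rV[R]_n -> W) : of_class k.+1 h -> of_class k h.
Proof.
elim: k h => [|k IH] h [hd hp]; first by move=> p; exact: differentiable_continuous.
by split=> // i; apply: IH.
Qed.

Lemma of_class_cst (R : realType) (n : nat) (W : normedModType R) (k : nat) (w : W) :
  of_class k (fun _ : 'rV[R]_n => w).
Proof.
elim: k w => [|k IH] w; first exact: cst_continuous.
split=> [p|i]; first exact: differentiable_cst.
rewrite (_ : partial i _ = fun=> 0); first exact: IH.
by apply/funext => p; rewrite /partial derive_cst.
Qed.

Lemma of_classD (R : realType) (n : nat) (W : normedModType R) (k : nat)
  (h1 h2 : 'rV[R]_n -> W) :
  of_class k h1 -> of_class k h2 -> of_class k (fun p => h1 p + h2 p).
Proof.
elim: k h1 h2 => [|k IH] h1 h2; first by move=> c1 c2 p; exact: (cvgD (c1 p) (c2 p)).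
move=> [d1 c1] [d2 c2]; split=> [p|i]; first exact: (differentiableD (d1 p) (d2 p)).
rewrite (_ : partial i _ = fun p => partial i h1 p + partial i h2 p).
  exact: (IH _ _ (c1 i) (c2 i)).
apply/funext => p; rewrite /partial.
by rewrite -(deriveD (diff_derivable (d1 p)) (diff_derivable (d2 p))).
Qed.

Lemma of_classM (R : realType) (n k : nat) (h1 h2 : 'rV[R]_n -> R) :
  of_class k h1 -> of_class k h2 -> of_class k (fun p => h1 p * h2 p).
Proof.
elim: k h1 h2 => [|k IH] h1 h2; first by move=> c1 c2 p; exact: (cvgM (c1 p) (c2 p)).
move=> h1k h2k; have [d1 c1] := h1k; have [d2 c2] := h2k.
split=> [p|i]; first exact: (differentiableM (d1 p) (d2 p)).
rewrite (_ : partial i _ = fun p => h1 p * partial i h2 p + h2 p * partial i h1 p).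
  by exact: (of_classD (IH _ _ (of_classW h1k) (c2 i)) (IH _ _ (of_classW h2k) (c1 i))).
apply/funext => p; rewrite /partial.
exact: (deriveM (diff_derivable (d1 p)) (diff_derivable (d2 p))).
Qed.

Lemma of_classZl (R : realType) (n k : nat) (W : normedModType R)
  (h : 'rV[R]_n -> R) (w : W) : of_class k h -> of_class k (fun p => h p *: w).
Proof.
elim: k h => [|k IH] h; first by move=> c p; exact: (cvgZr_tmp (c p)).
move=> [d c]; split=> [p|i]; first exact: differentiableZl.
rewrite (_ : partial i _ = fun p => partial i h p *: w); first exact: (IH _ (c i)).
apply/funext => p; rewrite /partial !deriveE//; last exact: differentiableZl.
by rewrite (diffZl _ (d p)).
Qed.

Lemma of_class_coord (R : realType) (n k : nat) (a : 'I_n) :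
  of_class k (fun p : 'rV[R]_n => p 0 a).
Proof.
case: k => [|k]; first by move=> p; exact: coord_continuous.
split=> [p|i]; first exact: differentiable_coord.
rewrite (_ : partial i _ = fun=> (delta_mx 0 i : 'rV[R]_n) 0 a); first exact: of_class_cst.
by apply/funext => p; rewrite /partial (@derive_val _ _ _ _ _ _ _ (is_derive_coord _ _ _)).
Qed.

Lemma differentiable_comp_coord (R : realType) (V : normedModType R) (m : nat) (a : 'I_m)
  (phi : V -> 'rV[R]_m) (p : V) :
  differentiable phi p -> differentiable (fun q => phi q 0 a) p.
Proof.
move=> d; exact: (differentiable_comp d (differentiable_coord (phi p) 0 a)).
Qed.

Lemma partial_coord (R : realType) (n m : nat) (a : 'I_m) (i : 'I_n)
  (phi : 'rV[R]_n -> 'rV[R]_m) (p : 'rV[R]_n) :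
  differentiable phi p -> partial i phi p 0 a = partial i (fun q => phi q 0 a) p.
Proof. by move=> d; rewrite /partial derive_mx ?mxE//; exact: diff_derivable. Qed.

Lemma of_class_comp_coord (R : realType) (n m k : nat) (a : 'I_m)
  (phi : 'rV[R]_n -> 'rV[R]_m) :
  of_class k phi -> of_class k (fun p => phi p 0 a).
Proof.
elim: k phi => [|k IH] phi.
  move=> c p; apply: (@continuous_comp _ _ _ phi (fun M : 'rV[R]_m => M 0 a)).
    exact: c.
  exact: coord_continuous.
move=> [d c]; split=> [p|i]; first exact: differentiable_comp_coord.
rewrite (_ : partial i _ = fun p => partial i phi p 0 a); first exact: (IH _ (c i)).
by apply/funext => p; rewrite partial_coord.
Qed.

Lemma partial_comm (R : realType) (n : nat) (i j : 'I_n) (h : 'rV[R]_n -> R) :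
  of_class 2 h -> partial i (partial j h) = partial j (partial i h).
Proof.
move=> [d0 H]; apply/funext => p.
have d1 k q : differentiable (partial k h) q by case: (H k) => + _; exact.
have c2 k l : continuous (partial k (partial l h)).
  by case: (H l) => _; exact.
exact (@derive_comm R _ h (delta_mx 0 j) (delta_mx 0 i) p
  (fun q => diff_derivable (d0 q)) (fun q => diff_derivable (d0 q))
  (fun q => diff_derivable (d1 j q)) (fun q => diff_derivable (d1 i q))
  (c2 i j p) (c2 j i p)).
Qed.

(** * Functions whose first or second partials vanish *)

(** Along the segment from [q] to [p] the derivative of [h] is a linear combination of its partials,
    hence 0. *)
Lemma eq_of_partial_eq0 (R : realType) (n : nat) (h : 'rV[R]_n -> R) (p q : 'rV[R]_n) :
  (forall p, differentiable h p) -> (forall i p, partial i h p = 0) -> h p = h q.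
Proof.
move=> d h0.
have dh0 i x : 'd h x (delta_mx 0 i) = 0 by rewrite -deriveE//; exact: h0.
have dl s : is_derive s (1 : R) (fun s => h (q + s *: (p - q))) 0.
  have <- : 'D_(p - q) h (q + s *: (p - q)) = 0.
    rewrite deriveE// [X in 'd _ _ X]row_sum_delta linear_sum big1//= => i _.
    by rewrite linearZ dh0; exact: mulr0.
  by apply: is_derive_line; exact: diff_derivable.
have := @is_derive_0_is_cst R _ 1 0 dl.
by rewrite scale1r scale0r addr0 addrCA subrr addr0.
Qed.

(** The first partials are constant by [eq_of_partial_eq0]; subtracting the linear function they
    define leaves a function without partials, to which the same lemma applies. *)
Lemma affine_of_partial2_eq0 (R : realType) (n : nat) (h : 'rV[R]_n -> R) :
  of_class 2 h -> (forall i j p, partial i (partial j h) p = 0) ->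
  (forall i p, partial i h p = partial i h 0) /\
  (forall p, h p = h 0 + \sum_i partial i h 0 * p 0 i).
Proof.
move=> [d0 H] h0.
have pc i p : partial i h p = partial i h 0.
  by apply: eq_of_partial_eq0 => // q; case: (H i) => + _; exact.
split=> // p.
pose l i := fun q : 'rV[R]_n => partial i h 0 * q 0 i.
have dl i q v : is_derive q v (l i) (partial i h 0 * v 0 i).
  exact: (is_deriveZ (partial i h 0) (is_derive_coord i q v)).
have ll i q : differentiable (l i) q.
  by apply: (differentiableZ (partial i h 0)); exact: differentiable_coord.
pose g := h - \sum_i l i.
have lE q : (\sum_i l i) q = \sum_i partial i h 0 * q 0 i by rewrite fct_sumE.
have gd q : differentiable g q by apply: differentiableB => //; exact: differentiable_sum.
have g0 i q : partial i g q = 0.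
  have := is_deriveB (derivableP (@diff_derivable _ _ _ _ _ (delta_mx 0 i) (d0 q)))
    (is_derive_sum (fun j => dl j q (delta_mx 0 i))).
  move=> /@derive_val; rewrite -/g /partial => ->.
  rewrite (bigD1 i)//= big1 => [|j ji]; last by rewrite mxE /= (negbTE ji) mulr0.
  by rewrite mxE !eqxx mulr1 addr0 -[X in X - _]/(partial i h q) pc subrr.
have gE q : g q = h q - \sum_i partial i h 0 * q 0 i by rewrite -lE.
have := eq_of_partial_eq0 p 0 gd g0; rewrite !gE => /eqP.
by rewrite subr_eq => /eqP ->; rewrite [in X in _ - X]big1 ?subr0// => i _; rewrite mxE mulr0.
Qed.

(** * Connection and curvature of [metric_f f]; the symmetric case *)

(** The Christoffel symbols with the factor f'(y) removed. As constants these pass through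
    [partial], so each further derivative acts on one function of y. *)
Definition gamma_coef (R : realType) (k i j : 'I_4) : R :=
  ((k == 3) && (i == 0) && (j == 0))%:R
  - ((k == 2) && ((i == 0) && (j == 1) || (i == 1) && (j == 0)))%:R.

(** Upper indices are always at least 2 and, by [gamma_coef_low], lower indices always below 2.
    Hence a product of two symbols contracted over an upper and a lower index vanishes, which
    removes all quadratic terms from the curvature. *)
Lemma gamma_coef_up (R : realType) (k i j : 'I_4) : (k < 2)%N -> gamma_coef R k i j = 0.
Proof. by case: k => [[|[|[|[|k]]]] ?]//= _; rewrite /gamma_coef /= subrr. Qed.

Lemma gamma_coef_low (R : realType) (k i j : 'I_4) :
  (2 <= i)%N || (2 <= j)%N -> gamma_coef R k i j = 0.
Proof.
case: i => [[|[|[|[|i]]]] ?]//=; case: j => [[|[|[|[|j]]]] ?]//= _;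
  by rewrite /gamma_coef /= !andbF subrr.
Qed.

(** Isolates the only part that varies with the point; the second summand is constant and disappears
    under [partial]. *)
Lemma metric_fE (R : realType) (f : R -> R) (p : 'rV[R]_4) (i j : 'I_4) :
  metric_f f p i j = f (p 0 1) * (- 2 * ((i == 0) && (j == 0))%:R)
    + metric_f (fun=> 0) 0 i j.
Proof. by rewrite !mxE /=; ring. Qed.

Lemma is_derive_comp_coord (R : realType) (F : R -> R) (c : R) (p v : 'rV[R]_4) :
  derivable F (p 0 1) 1 ->
  is_derive p v (fun q : 'rV[R]_4 => F (q 0 1) * c) ((F^`())%classic (p 0 1) * v 0 1 * c).
Proof.
move=> Fd; have /derivableP := Fd; rewrite -derive1E => Fd'.
have := is_derive_comp Fd' (differentiable_coord p 0 1) (is_derive_coord 1 p v).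
move=> /(is_deriveZ c) H.
rewrite (_ : (fun q => _) = c \*: (fun q : 'rV[R]_4 => F (q 0 1))); last first.
  by apply/funext => q; rewrite mulrC.
by rewrite mulrC.
Qed.

Lemma partial_comp_coord (R : realType) (F : R -> R) (c : R) (k : 'I_4) (p : 'rV[R]_4) :
  derivable F (p 0 1) 1 ->
  partial k (fun q : 'rV[R]_4 => F (q 0 1) * c) p = (F^`())%classic (p 0 1) * ((k == 1)%:R * c).
Proof.
move=> Fd; rewrite /partial (@derive_val _ _ _ _ _ _ _ (is_derive_comp_coord _ _ Fd)).
by rewrite mxE /= eq_sym mulrA.
Qed.

Lemma partial_metric_f (R : realType) (f : R -> R) (i j k : 'I_4) (p : 'rV[R]_4) :
  derivable f (p 0 1) 1 ->
  partial k (fun q => metric_f f q i j) p =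
    (f^`())%classic (p 0 1) * ((k == 1)%:R * (- 2 * ((i == 0) && (j == 0))%:R)).
Proof.
move=> fd; rewrite -partial_comp_coord// /partial.
set c := - 2 * _; pose d := metric_f (fun=> 0) (0 : 'rV[R]_4) i j.
have H := is_derive_comp_coord c (delta_mx 0 k) fd.
have Hd := is_deriveD H (is_derive_cst d p (delta_mx 0 k)).
rewrite (_ : (fun q => _) = (fun q : 'rV[R]_4 => f (q 0 1) * c) + cst d); last first.
  by apply/funext => q; rewrite metric_fE.
by rewrite (@derive_val _ _ _ _ _ _ _ Hd) addr0 (@derive_val _ _ _ _ _ _ _ H).
Qed.

Lemma invmx_metric_f (R : realType) (f : R -> R) (p : 'rV[R]_4) :
  invmx (metric_f f p) = (2 * f (p 0 1)) *: delta_mx 2 2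
    + delta_mx 0 2 + delta_mx 2 0 + delta_mx 1 3 + delta_mx 3 1.
Proof.
set h := RHS; suff E : metric_f f p *m h = 1%:M.
  by rewrite -[LHS]mulmx1 -E mulKmx// metric_f_unit.
apply/matrixP => i j; rewrite !mxE !big_ord_recl big_ord0 !mxE /=.
by case: i => [[|[|[|[|i]]]] ?] //; case: j => [[|[|[|[|j]]]] ?] //;
   rewrite /=; ring.
Qed.

Lemma christoffel_metric_f (R : realType) (f : R -> R) (k i j : 'I_4) :
  (forall y, derivable f y 1) ->
  christoffel (metric_f f) k i j = fun p => (f^`())%classic (p 0 1) * gamma_coef R k i j.
Proof.
move=> fd; apply/funext => p; rewrite /christoffel invmx_metric_f.
under eq_bigr do rewrite !partial_metric_f//.
move: ((f^`())%classic _) (f _) => f' f0.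
rewrite !big_ord_recl big_ord0 !mxE /gamma_coef.
by case: k => [[|[|[|[|k]]]] ?] //; case: i => [[|[|[|[|i]]]] ?] //;
   case: j => [[|[|[|[|j]]]] ?] //; rewrite /=; field.
Qed.

(** The curvature with the factor f''(y) removed: only the coordinate y, of index 1, differentiates
    f'(y), which explains the two indicators. *)
Definition curvature_coef (R : realType) (l i j k : 'I_4) : R :=
  (i == 1)%:R * gamma_coef R l j k - (j == 1)%:R * gamma_coef R l i k.

Lemma curvature_metric_f (R : realType) (f : R -> R) (l i j k : 'I_4) :
  (forall y, derivable f y 1) -> (forall y, derivable (f^`())%classic y 1) ->
  curvature (metric_f f) l i j k = fun p => (f^`()^`())%classic (p 0 1) * curvature_coef R l i j k.
Proof.
move=> fd fd'; apply/funext => p; rewrite /curvature !christoffel_metric_f// !partial_comp_coord//.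
rewrite big1 ?addr0 => [|s _]; first by rewrite -mulrBr.
rewrite !christoffel_metric_f//.
case: (ltnP s 2) => s2; first by rewrite ![gamma_coef R s _ _]gamma_coef_up// !mulr0 subrr.
by rewrite ![gamma_coef R _ _ s]gamma_coef_low ?s2 ?orbT// !(mulr0, mul0r) subrr.
Qed.

(** The curvature has the index pattern of the connection, upper index at least 2 and lower indices
    below 2, so every correction term of the covariant derivative vanishes. *)
Lemma nabla_curvature_metric_f (R : realType) (f : R -> R) (m l i j k : 'I_4) p :
  (forall y, derivable f y 1) -> (forall y, derivable (f^`())%classic y 1) ->
  (forall y, derivable (f^`()^`())%classic y 1) ->
  nabla_curvature (metric_f f) m l i j k p =
    (f^`()^`()^`())%classic (p 0 1) * ((m == 1)%:R * curvature_coef R l i j k).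
Proof.
move=> fd fd' fd''; rewrite /nabla_curvature !curvature_metric_f// partial_comp_coord//.
rewrite big1 ?addr0// => s _.
rewrite !christoffel_metric_f// !curvature_metric_f// /curvature_coef.
case: (ltnP s 2) => s2.
  by rewrite ![gamma_coef R s _ _]gamma_coef_up// !(mulr0, subr0, mul0r).
have s1 : (s == 1) = false by apply/eqP => s1; rewrite s1 in s2.
rewrite s1 ![gamma_coef R _ _ s]gamma_coef_low ?s2 ?orbT//.
by rewrite ![gamma_coef R _ s _]gamma_coef_low ?s2// !(mulr0, subr0, mul0r).
Qed.

Lemma symmetric_metric_f (R : realType) (f : R -> R) :
  (forall y, derivable f y 1) -> (forall y, derivable (f^`())%classic y 1) ->
  (forall y, derivable (f^`()^`())%classic y 1) ->
  symmetric_manifold (metric_f f) <-> (forall y : R, (f^`()^`()^`())%classic y = 0).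
Proof.
move=> fd fd' fd''; split=> [H y|H m l i j k p]; last first.
  by rewrite nabla_curvature_metric_f// H mul0r.
(* For these indices the constant coefficient is 1, so this component of nabla R is f'''(y)
   itself. *)
have := H 1 3 1 0 0 (\row_i y); rewrite nabla_curvature_metric_f// mxE.
by rewrite /curvature_coef /gamma_coef /= !(mul1r, mul0r, subr0, mulr1).
Qed.

(** * Isometries and the Koszul formula *)

Lemma metric_form_delta (R : realType) (n : nat) (g : metric R n) (p : 'rV[R]_n) (i j : 'I_n) :
  metric_form g p (delta_mx 0 i) (delta_mx 0 j) = g p i j.
Proof. by rewrite /metric_form -rowE trmx_delta -colE !mxE. Qed.

(** The Jacobian matrix [J] satisfies J g(phi p) J^T = g(p). As the right side is invertible, so are
    [J] and g(phi p), and a vector orthogonal to all rows of [J] is 0. *)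
Lemma isometry_nondegenerate (R : realType) (n : nat) (g : metric R n)
  (phi : 'rV[R]_n -> 'rV[R]_n) (p w : 'rV[R]_n) :
  g p \in unitmx -> is_isometry g phi ->
  (forall k, metric_form g (phi p) w ('d phi p (delta_mx 0 k)) = 0) -> w = 0.
Proof.
move=> gu [_ iso] w0; pose J := \matrix_k ('d phi p (delta_mx 0 k) : 'rV[R]_n).
have JE : J *m g (phi p) *m J^T = g p.
  apply/matrixP => i j; rewrite -metric_form_delta -iso /metric_form !mxE.
  by apply: eq_bigr => s _; rewrite !mxE; congr (_ * _); apply: eq_bigr => t _; rewrite !mxE.
move: gu; rewrite -JE !unitmx_mul => /andP[/andP[_ Gu] Ju].
have : w *m g (phi p) *m J^T = 0.
  apply/rowP => k; rewrite [RHS]mxE -(w0 k) /metric_form !mxE.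
  by apply: eq_bigr => s _; rewrite !mxE.
move=> /(congr1 (fun A => A *m invmx J^T *m invmx (g (phi p)))).
by rewrite /= mulmxK// mulmxK// !mul0mx.
Qed.

Lemma metric_form_metric_f (R : realType) (f : R -> R) (q u v : 'rV[R]_4) :
  metric_form (metric_f f) q u v = - 2 * f (q 0 1) * (u 0 0 * v 0 0)
    + (u 0 0 * v 0 2 + u 0 2 * v 0 0) + (u 0 1 * v 0 3 + u 0 3 * v 0 1).
Proof.
have e1 : lift ord0 ord0 = 1 :> 'I_4 by exact/val_inj.
have e2 : lift ord0 (lift ord0 ord0) = 2 :> 'I_4 by exact/val_inj.
have e3 : lift ord0 (lift ord0 (lift ord0 ord0)) = 3 :> 'I_4 by exact/val_inj.
rewrite /metric_form !mxE !big_ord_recl !big_ord0 !mxE !big_ord_recl !big_ord0 !mxE /=.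
by rewrite e3 e2 e1; ring.
Qed.

Lemma is_derive_mul (R : realType) (V : normedModType R) (g h : V -> R) (p v : V) (dg dh : R) :
  is_derive p v g dg -> is_derive p v h dh ->
  is_derive p v (fun q => g q * h q) (g p * dh + dg * h p).
Proof. by move=> gd hd; rewrite [dg * _]mulrC; exact: (is_deriveM gd hd). Qed.

Lemma is_derive_add (R : realType) (V : normedModType R) (g h : V -> R) (p v : V) (dg dh : R) :
  is_derive p v g dg -> is_derive p v h dh ->
  is_derive p v (fun q => g q + h q) (dg + dh).
Proof. by move=> gd hd; exact: (is_deriveD gd hd). Qed.

Lemma is_derive_scale (R : realType) (V : normedModType R) (c : R) (h : V -> R) (p v : V) (dh : R) :
  is_derive p v h dh -> is_derive p v (fun q => c * h q) (c * dh).
Proof. by move=> hd; exact: (is_deriveZ c hd). Qed.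

Lemma is_derive_partial (R : realType) (n : nat) (h : 'rV[R]_n -> R) (i : 'I_n) (p : 'rV[R]_n) :
  of_class 1 h -> is_derive p (delta_mx 0 i) h (partial i h p).
Proof. by move=> [hd _]; apply: derivableP; exact: diff_derivable. Qed.

(** The product rule applied to the isometry equation for the pair (i, j), differentiated in
    direction k. *)
Lemma partial_pullback (R : realType) (f : R -> R) (X Y Z W : 'rV[R]_4 -> R) :
  (forall y, derivable f y 1) ->
  of_class 2 X -> of_class 2 Y -> of_class 2 Z -> of_class 2 W ->
  (forall i j p, - 2 * (f (Y p) * (partial i X p * partial j X p))
    + (partial i X p * partial j Z p + partial i Z p * partial j X p)
    + (partial i Y p * partial j W p + partial i W p * partial j Y p) = metric_f f p i j) ->
  forall i j k p,
   - 2 * (f (Y p) * (partial i X p * partial k (partial j X) p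
                     + partial k (partial i X) p * partial j X p)
          + derive1 f (Y p) * partial k Y p * (partial i X p * partial j X p))
    + (partial i X p * partial k (partial j Z) p + partial k (partial i X) p * partial j Z p
       + (partial i Z p * partial k (partial j X) p + partial k (partial i Z) p * partial j X p))
    + (partial i Y p * partial k (partial j W) p + partial k (partial i Y) p * partial j W p
       + (partial i W p * partial k (partial j Y) p + partial k (partial i W) p * partial j Y p))
   = derive1 f (p 0 1) * ((k == 1)%:R * (- 2 * ((i == 0)%:R * (j == 0)%:R))).
Proof.
move=> fd X2 Y2 Z2 W2 E i j k p.
have d1 (h : 'rV[R]_4 -> R) (l : 'I_4) : of_class 2 h ->
    is_derive p (delta_mx 0 k) (partial l h) (partial k (partial l h) p).
  by move=> [_ H]; exact: (is_derive_partial k p (H l)).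
have [Yd _] := Y2.
have /derivableP := fd (Y p); rewrite -derive1E => fYd.
have DfY := is_derive_comp fYd (Yd p) (is_derive_partial k p (of_classW Y2)).
have T1 := is_derive_scale (- 2) (is_derive_mul DfY (is_derive_mul (d1 X i X2) (d1 X j X2))).
have T2 := is_derive_add (is_derive_mul (d1 X i X2) (d1 Z j Z2)) (is_derive_mul (d1 Z i Z2) (d1 X j X2)).
have T3 := is_derive_add (is_derive_mul (d1 Y i Y2) (d1 W j W2)) (is_derive_mul (d1 W i W2) (d1 Y j Y2)).
have /@derive_val := is_derive_add (is_derive_add T1 T2) T3 => <-.
rewrite (_ : (fun q => _) = (fun q => metric_f f q i j)); last by apply/funext => q; rewrite -E.
by rewrite -[LHS]/(partial k (fun q => metric_f f q i j) p) partial_metric_f// -mulnb natrM.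
Qed.

(** Half of the combination d_i g_jk + d_j g_ik - d_k g_ij of [partial_pullback]: by symmetry of
    mixed partials, only the second derivatives in (i, j) survive. The left side pairs nabla_i d_j
    phi with d_k phi; the right side is the Christoffel symbol of the first kind of the source. *)
Lemma koszul_pullback (R : realType) (f : R -> R) (X Y Z W : 'rV[R]_4 -> R) :
  (forall y, derivable f y 1) ->
  of_class 2 X -> of_class 2 Y -> of_class 2 Z -> of_class 2 W ->
  (forall i j p, - 2 * (f (Y p) * (partial i X p * partial j X p))
    + (partial i X p * partial j Z p + partial i Z p * partial j X p)
    + (partial i Y p * partial j W p + partial i W p * partial j Y p) = metric_f f p i j) ->
  forall i j k p,
   - derive1 f (Y p) * (partial i Y p * (partial j X p * partial k X p)
       + partial j Y p * (partial i X p * partial k X p)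
       - partial k Y p * (partial i X p * partial j X p))
   - 2 * f (Y p) * (partial i (partial j X) p * partial k X p)
   + (partial i (partial j X) p * partial k Z p + partial i (partial j Z) p * partial k X p)
   + (partial i (partial j Y) p * partial k W p + partial i (partial j W) p * partial k Y p)
  = derive1 f (p 0 1) * ((k == 1)%:R * (i == 0)%:R * (j == 0)%:R
      - (k == 0)%:R * ((i == 0)%:R * (j == 1)%:R + (i == 1)%:R * (j == 0)%:R)).
Proof.
move=> fd X2 Y2 Z2 W2 E i j k p.
have D := partial_pullback fd X2 Y2 Z2 W2 E.
have := D i j k p; have := D i k j p; have := D j k i p.
move: (partial_comm j i X2) (partial_comm j i Y2) (partial_comm j i Z2) (partial_comm j i W2)
  (partial_comm k i X2) (partial_comm k i Y2) (partial_comm k i Z2) (partial_comm k i W2)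
  (partial_comm k j X2) (partial_comm k j Y2) (partial_comm k j Z2) (partial_comm k j W2).
(* With [partial] opaque the rewriting below cannot unfold it. *)
move: (@partial R 4 _) => D_.
move=> -> -> -> -> -> -> -> -> -> -> -> ->.
move: (derive1 f _) (f _) (derive1 f _) => f1 f0 f2.
move: (D_ i (D_ j X) p) (D_ i (D_ j Y) p) (D_ i (D_ j Z) p)
  (D_ i (D_ j W) p) => Xij Yij Zij Wij.
move: (D_ i (D_ k X) p) (D_ i (D_ k Y) p) (D_ i (D_ k Z) p)
  (D_ i (D_ k W) p) => Xik Yik Zik Wik.
move: (D_ j (D_ k X) p) (D_ j (D_ k Y) p) (D_ j (D_ k Z) p)
  (D_ j (D_ k W) p) => Xjk Yjk Zjk Wjk.
move: (D_ i X p) (D_ i Y p) (D_ i Z p) (D_ i W p) => Xi Yi Zi Wi.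
move: (D_ j X p) (D_ j Y p) (D_ j Z p) (D_ j W p) => Xj Yj Zj Wj.
move: (D_ k X p) (D_ k Y p) (D_ k Z p) (D_ k W p) => Xk Yk Zk Wk.
move: ((k == 1)%:R : R) ((k == 0)%:R : R) ((i == 1)%:R : R) ((i == 0)%:R : R)
 ((j == 1)%:R : R) ((j == 0)%:R : R) => k1 k0 i1 i0 j1 j0 E1 E2 E3.
lra.
Qed.

Lemma smooth_coord (R : realType) (n m : nat) (phi : 'rV[R]_n -> 'rV[R]_m) (a : 'I_m) :
  smooth phi -> smooth (fun p => phi p 0 a).
Proof. by move=> H k; exact: of_class_comp_coord. Qed.

Lemma diff_coord (R : realType) (n m : nat) (phi : 'rV[R]_n -> 'rV[R]_m) (a : 'I_m)
  (i : 'I_n) (p : 'rV[R]_n) :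
  smooth phi -> ('d phi p (delta_mx 0 i) : 'rV[R]_m) 0 a = partial i (fun p => phi p 0 a) p.
Proof. by move=> /(_ 1)[d _]; rewrite -deriveE// -partial_coord. Qed.

Lemma pullback_metric_f (R : realType) (f : R -> R) (phi : 'rV[R]_4 -> 'rV[R]_4) :
  is_isometry (metric_f f) phi ->
  let X p := phi p 0 0 in let Y p := phi p 0 1 in
  let Z p := phi p 0 2 in let W p := phi p 0 3 in
  forall i j p, - 2 * (f (Y p) * (partial i X p * partial j X p))
    + (partial i X p * partial j Z p + partial i Z p * partial j X p)
    + (partial i Y p * partial j W p + partial i W p * partial j Y p) = metric_f f p i j.
Proof.
move=> [[sm _] iso] X Y Z W i j p.
by rewrite -metric_form_delta -iso metric_form_metric_f !diff_coord// -(mulrA (- 2)).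
Qed.

(** * The second order system of an isometry and its integrability conditions *)

(** An isometry preserves the connection. The Christoffel symbols at the image point have upper
    index 2 or 3, so for the components X and Y only those at [p] contribute and the system is
    linear. *)
Lemma second_partial_isometry (R : realType) (f : R -> R) (phi : 'rV[R]_4 -> 'rV[R]_4) :
  (forall y, derivable f y 1) -> is_isometry (metric_f f) phi ->
  forall (a i j : 'I_4) p, (a < 2)%N ->
  partial i (partial j (fun p => phi p 0 a)) p = derive1 f (p 0 1) *
    ((i == 0)%:R * (j == 0)%:R * partial 3 (fun p => phi p 0 a) p
     - ((i == 0)%:R * (j == 1)%:R + (i == 1)%:R * (j == 0)%:R) *
       partial 2 (fun p => phi p 0 a) p).
Proof.
move=> fd iso a i j p a2.
have [[sm _] _] := iso; have E := pullback_metric_f iso.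
have sc b := smooth_coord b sm.
have K := koszul_pullback fd (sc 0 2%N) (sc 1 2%N) (sc 2 2%N) (sc 3 2%N) E.
pose F (b : 'I_4) p := phi p 0 b.
(* The term Gamma^b(d_i phi, d_j phi) of the connection at the image point. *)
pose corr (b : 'I_4) : R :=
  if b == 2 then - derive1 f (F 1 p) * (partial i (F 0) p * partial j (F 1) p
    + partial j (F 0) p * partial i (F 1) p)
  else if b == 3 then derive1 f (F 1 p) * (partial i (F 0) p * partial j (F 0) p) else 0.
(* [w] is nabla_i d_j phi - d phi (nabla_i d_j); by Koszul's formula it is
   orthogonal to the image of [d phi]. *)
pose w : 'rV[R]_4 := \row_b (partial i (partial j (F b)) p + corr b
  - derive1 f (p 0 1) * ((i == 0)%:R * (j == 0)%:R * partial 3 (F b) p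
     - ((i == 0)%:R * (j == 1)%:R + (i == 1)%:R * (j == 0)%:R) * partial 2 (F b) p)).
suff : w = 0.
  move=> /rowP/(_ a); rewrite !mxE /corr.
  have -> : (a == 2) = false by apply/negP => /eqP aE; rewrite aE in a2.
  have -> : (a == 3) = false by apply/negP => /eqP aE; rewrite aE in a2.
  by rewrite addr0 => /eqP; rewrite subr_eq0 => /eqP.
apply: (isometry_nondegenerate (metric_f_unit f p) iso) => k.
rewrite metric_form_metric_f !diff_coord// !mxE /corr /=.
rewrite -!/(F _); have := K i j k p; have := E 3 k p; have := E 2 k p.
rewrite -!/(F _).
rewrite -[phi p 0 1]/(F 1 p).
have -> : metric_f f p 2 k = (k == 0)%:R by rewrite !mxE /=; ring.
have -> : metric_f f p 3 k = (k == 1)%:R by rewrite !mxE /=; ring.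
move: (partial i (partial j (F 0)) p) (partial i (partial j (F 1)) p) (partial i (partial j (F 2)) p)
  (partial i (partial j (F 3)) p) => Xij Yij Zij Wij.
move: (derive1 f _) (f _) (derive1 f _) => f1 f0 f2.
move: (partial i (F 0) p) (partial i (F 1) p) => Xi Yi.
move: (partial j (F 0) p) (partial j (F 1) p) => Xj Yj.
move: (partial 2 (F 0) p) (partial 2 (F 1) p) (partial 2 (F 2) p) (partial 2 (F 3) p) => X2 Y2 Z2 W2.
move: (partial 3 (F 0) p) (partial 3 (F 1) p) (partial 3 (F 2) p) (partial 3 (F 3) p) => X3 Y3 Z3 W3.
move: (partial k (F 0) p) (partial k (F 1) p) (partial k (F 2) p) (partial k (F 3) p) => Xk Yk Zk Wk.
move: ((k == 1)%:R : R) ((k == 0)%:R : R) ((i == 1)%:R : R) ((i == 0)%:R : R)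
 ((j == 1)%:R : R) ((j == 0)%:R : R) => k1 k0 i1 i0 j1 j0 E2 E3 EK.
(* The metric identities for (3, k) and (2, k) are multiplied by the Christoffel coefficients at
   [p]; the goal is then a linear combination of hypotheses, as [lra] requires. *)
have := congr1 (fun x => f1 * (i0 * j0) * x) E3.
have := congr1 (fun x => f1 * (i0 * j1 + i1 * j0) * x) E2.
cbv beta => E2' E3'.
lra.
Qed.

(* Commuting [partial 1] and [partial 0] on [partial 0 h] and on [partial 1 h] gives
   [f'' * partial 3 h = 0] and [f'' * partial 2 h = 0]. *)
Lemma partials_of_second_partial (R : realType) (f : R -> R) (y0 : R) (h : 'rV[R]_4 -> R) :
  (forall y, derivable (derive1 f) y 1) -> derive1 (derive1 f) y0 != 0 -> smooth h ->
  (forall i j p, partial i (partial j h) p = derive1 f (p 0 1) *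
    ((i == 0)%:R * (j == 0)%:R * partial 3 h p
     - ((i == 0)%:R * (j == 1)%:R + (i == 1)%:R * (j == 0)%:R) * partial 2 h p)) ->
  [/\ forall p, partial 2 h p = 0, forall p, partial 3 h p = 0
    & forall i j p, partial i (partial j h) p = 0].
Proof.
move=> fd f0 sm H.
have d i q : differentiable (partial i h) q by case: (sm 2%N) => _ /(_ i)[].
have c2 i : of_class 2 (partial i h) by case: (sm 3%N) => _; exact.
(* The right side of [H] is 0 for j = 2 and j = 3, so these two partials are constants. *)
have h2 p : partial 2 h p = partial 2 h 0.
  by apply: eq_of_partial_eq0 => // i q; rewrite H /= !(mulr0, mul0r, subr0, addr0).
have h3 p : partial 3 h p = partial 3 h 0.
  by apply: eq_of_partial_eq0 => // i q; rewrite H /= !(mulr0, mul0r, subr0, addr0).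
move: (partial 2 h 0) (partial 3 h 0) h2 h3 => a2 a3 h2 h3.
have H00 : partial 0 (partial 0 h) = fun p => derive1 f (p 0 1) * a3.
  by apply/funext => p; rewrite H h2 h3 /=; ring.
have H01 : partial 0 (partial 1 h) = fun p => derive1 f (p 0 1) * - a2.
  by apply/funext => p; rewrite H h2 h3 /=; ring.
have H10 : partial 1 (partial 0 h) = fun p => derive1 f (p 0 1) * - a2.
  by apply/funext => p; rewrite H h2 h3 /=; ring.
have H11 : partial 1 (partial 1 h) = fun p => derive1 f (p 0 1) * 0.
  by apply/funext => p; rewrite H h2 h3 /=; ring.
have p0E : (\row_(_ < 4) y0 : 'rV[R]_4) 0 1 = y0 by rewrite mxE.
have a30 : a3 = 0.
  have := congr1 (fun g => g (\row_(_ < 4) y0)) (partial_comm 1 0 (c2 0)).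
  rewrite H00 H10 !partial_comp_coord// p0E /= mul1r mul0r mulr0 => /eqP.
  by rewrite mulf_eq0 (negbTE f0) /= => /eqP.
have a20 : a2 = 0.
  have := congr1 (fun g => g (\row_(_ < 4) y0)) (partial_comm 1 0 (c2 1)).
  rewrite H01 H11 !partial_comp_coord// p0E /= mul1r !mul0r mulr0 => /eqP.
  by rewrite mulf_eq0 (negbTE f0) /= oppr_eq0 => /eqP.
split=> [p|p|i j p]; first by rewrite h2.
  by rewrite h3.
by rewrite H h2 h3 a20 a30 !mulr0 subrr mulr0.
Qed.

Lemma is_derive_scaler (R : realType) (V : normedModType R) (c : R) (h : V -> R) (p v : V) (dh : R) :
  is_derive p v h dh -> is_derive p v (fun q => h q * c) (dh * c).
Proof.
move=> hd; rewrite (_ : (fun q => h q * c) = (fun q => c * h q)).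
  by rewrite mulrC; exact: is_derive_scale.
by apply/funext => q; rewrite mulrC.
Qed.

(* Apply [partial 1] to the hypothesis at (i, j, k) = (0, 0, 1) and [partial 0] to it at
   (0, 1, 1): the third partials of [Z] and [W] agree by symmetry. *)
Lemma hessian_of_koszul (R : realType) (f : R -> R) (X Y Z W : 'rV[R]_4 -> R)
  (al be ga de : R) :
  (forall y, derivable (derive1 f) y 1) -> of_class 2 Y -> of_class 3 Z -> of_class 3 W ->
  (forall i j k p,
   - derive1 f (Y p) * (partial i Y p * (partial j X p * partial k X p)
       + partial j Y p * (partial i X p * partial k X p)
       - partial k Y p * (partial i X p * partial j X p))
   - 2 * f (Y p) * (partial i (partial j X) p * partial k X p)
   + (partial i (partial j X) p * partial k Z p + partial i (partial j Z) p * partial k X p)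
   + (partial i (partial j Y) p * partial k W p + partial i (partial j W) p * partial k Y p)
  = derive1 f (p 0 1) * ((k == 1)%:R * (i == 0)%:R * (j == 0)%:R
      - (k == 0)%:R * ((i == 0)%:R * (j == 1)%:R + (i == 1)%:R * (j == 0)%:R))) ->
  (forall p, partial 0 X p = al) -> (forall p, partial 1 X p = be) ->
  (forall p, partial 0 Y p = ga) -> (forall p, partial 1 Y p = de) ->
  (forall i j p, partial i (partial j X) p = 0) ->
  (forall i j p, partial i (partial j Y) p = 0) ->
  forall p : 'rV[R]_4,
  derive1 (derive1 f) (p 0 1) = (al * de - be * ga) ^+ 2 * derive1 (derive1 f) (Y p).
Proof.
move=> fd' Y2 Z3 W3 K X0 X1 Y0 Y1 Xij Yij p.
have Z2 := Z3.2 0; have W2 := W3.2 0.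
have E00 q : partial 0 (partial 0 Z) q * be + partial 0 (partial 0 W) q * de =
    derive1 f (q 0 1) * 1 + derive1 f (Y q) * (2 * (ga * al * be) - de * al * al).
  have := K 0 0 1 q; rewrite (Xij 0 0) (Yij 0 0) X0 X1 Y0 Y1 /=.
  move: (f (Y q)) (derive1 f (Y q)) (derive1 f (q 0 1)) (partial 1 Z q) (partial 1 W q)
    (partial 0 (partial 0 Z) q) (partial 0 (partial 0 W) q) => f0 f1 f2 z w z0 w0 H.
  by lra.
have E01 q : partial 1 (partial 0 Z) q * be + partial 1 (partial 0 W) q * de =
    derive1 f (Y q) * (ga * be * be).
  rewrite (partial_comm 1 0 (of_classW Z3)) (partial_comm 1 0 (of_classW W3)).
  have := K 0 1 1 q; rewrite (Xij 0 1) (Yij 0 1) X0 X1 Y0 Y1 /=.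
  move: (f (Y q)) (derive1 f (Y q)) (derive1 f (q 0 1)) (partial 1 Z q) (partial 1 W q)
    (partial 0 (partial 1 Z) q) (partial 0 (partial 1 W) q) => f0 f1 f2 z w z0 w0 H.
  by lra.
have dE00 : is_derive p (delta_mx 0 1)
    (fun q => partial 0 (partial 0 Z) q * be + partial 0 (partial 0 W) q * de)
    (partial 1 (partial 0 (partial 0 Z)) p * be + partial 1 (partial 0 (partial 0 W)) p * de).
  have [_ Z1] := Z2; have [_ W1] := W2.
  exact: (is_derive_add (is_derive_scaler be (is_derive_partial 1 p (Z1 0)))
    (is_derive_scaler de (is_derive_partial 1 p (W1 0)))).
have dE01 : is_derive p (delta_mx 0 0)
    (fun q => partial 1 (partial 0 Z) q * be + partial 1 (partial 0 W) q * de)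
    (partial 0 (partial 1 (partial 0 Z)) p * be + partial 0 (partial 1 (partial 0 W)) p * de).
  have [_ Z1] := Z2; have [_ W1] := W2.
  exact: (is_derive_add (is_derive_scaler be (is_derive_partial 0 p (Z1 1)))
    (is_derive_scaler de (is_derive_partial 0 p (W1 1)))).
have /derivableP := fd' (Y p); rewrite -derive1E => f'd.
have [Yd _] := of_classW Y2.
have dY i := is_derive_comp f'd (Yd p) (is_derive_partial i p (of_classW Y2)).
have dR (m : R) i : is_derive p (delta_mx 0 i) (fun q => derive1 f (Y q) * m)
    (derive1 (derive1 f) (Y p) * partial i Y p * m).
  exact: is_derive_scaler (dY i).
have D1 : partial 1 (partial 0 (partial 0 Z)) p * be + partial 1 (partial 0 (partial 0 W)) p * de
   = derive1 (derive1 f) (p 0 1) * 1 * 1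
     + derive1 (derive1 f) (Y p) * de * (2 * (ga * al * be) - de * al * al).
  have := is_derive_add (is_derive_comp_coord 1 (delta_mx 0 1) (fd' (p 0 1)))
    (dR (2 * (ga * al * be) - de * al * al) 1).
  rewrite mxE eqxx /= Y1 => /@derive_val <-.
  rewrite -(@derive_val _ _ _ _ _ _ _ dE00).
  by congr ('D_(delta_mx 0 1) _ p); apply/funext => q.
have D2 : partial 0 (partial 1 (partial 0 Z)) p * be + partial 0 (partial 1 (partial 0 W)) p * de
   = derive1 (derive1 f) (Y p) * ga * (ga * be * be).
  have := dR (ga * be * be) 0.
  rewrite Y0 => /@derive_val <-.
  rewrite -(@derive_val _ _ _ _ _ _ _ dE01).
  by congr ('D_(delta_mx 0 0) _ p); apply/funext => q.
(* Equating the two third-derivative expressions leaves f''(y) = f''(Y) (al^2 de^2 - 2 al be ga de +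
   be^2 ga^2), a perfect square. *)
have alg (z w z' w' f1 f2 : R) : z = z' -> w = w' ->
    z * be + w * de = f1 * 1 * 1 + f2 * de * (2 * (ga * al * be) - de * al * al) ->
    z' * be + w' * de = f2 * ga * (ga * be * be) -> f1 = (al * de - be * ga) ^+ 2 * f2.
  move=> -> -> -> D; have -> : f1 = f1 * 1 * 1 by rewrite !mulr1.
  by apply: (addIr (f2 * de * (2 * (ga * al * be) - de * al * al))); rewrite D; ring.
exact: (alg _ _ _ _ _ _ (congr1 (fun g => g p) (partial_comm 1 0 Z2))
  (congr1 (fun g => g p) (partial_comm 1 0 W2)) D1 D2).
Qed.

(** * The functional equation for f'' and its solutions *)

(** X and Y are affine, and Y does not involve the last two coordinates. [K] is the square of the
    Jacobian determinant of (X, Y) in (x, y), so it depends on [phi] but not on [p]. *)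
Lemma hessian_functional_equation (R : realType) (f : R -> R) (y0 : R)
  (phi : 'rV[R]_4 -> 'rV[R]_4) :
  (forall y, derivable f y 1) -> (forall y, derivable (derive1 f) y 1) ->
  derive1 (derive1 f) y0 != 0 -> is_isometry (metric_f f) phi ->
  exists K c d e : R, forall p,
    phi p 0 1 = e + (c * p 0 0 + d * p 0 1) /\
    derive1 (derive1 f) (p 0 1) = K * derive1 (derive1 f) (phi p 0 1).
Proof.
move=> fd fd' f0 iso; have [[sm _] _] := iso.
have E := pullback_metric_f iso.
have sc b := smooth_coord b sm.
have K := koszul_pullback fd (sc 0 2%N) (sc 1 2%N) (sc 2 2%N) (sc 3 2%N) E.
have S := second_partial_isometry fd iso.
have [X2 X3 Xij] := partials_of_second_partial fd' f0 (sc 0) (fun i j p => S 0 i j p isT).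
have [Y2 Y3 Yij] := partials_of_second_partial fd' f0 (sc 1) (fun i j p => S 1 i j p isT).
have [Xi _] := affine_of_partial2_eq0 (sc 0 2%N) Xij.
have [Yi YE] := affine_of_partial2_eq0 (sc 1 2%N) Yij.
have Z3 := sc 2 3%N; have W3 := sc 3 3%N.
have H := hessian_of_koszul fd' (sc 1 2%N) Z3 W3 K (Xi 0) (Xi 1) (Yi 0) (Yi 1) Xij Yij.
eexists; eexists; eexists; eexists => p; split; last exact: H.
rewrite YE !big_ord_recl big_ord0 /=.
have -> : lift ord0 (lift ord0 (lift ord0 ord0)) = 3 :> 'I_4 by exact/val_inj.
have -> : lift ord0 (lift ord0 ord0) = 2 :> 'I_4 by exact/val_inj.
have -> : lift ord0 ord0 = 1 :> 'I_4 by exact/val_inj.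
by rewrite Y2 Y3 !mul0r !addr0.
Qed.

(* [h / h'] has derivative [1 - m], hence is affine; having no zero it is constant. *)
Lemma exp_of_mul_derive2 (R : realType) (h : R -> R) (m : R) :
  (forall y, derivable h y 1) -> (forall y, derivable (derive1 h) y 1) ->
  (forall y, h y != 0) -> (forall y, derive1 h y != 0) ->
  (forall y, h y * derive1 (derive1 h) y = m * derive1 h y ^+ 2) ->
  exists a lambda : R, forall y, h y = a * expR (lambda * y).
Proof.
move=> hd h'd h0 h'0 H.
have dh y : is_derive y (1 : R) h (derive1 h y) by rewrite derive1E; exact: derivableP.
have dh' y : is_derive y (1 : R) (derive1 h) (derive1 (derive1 h) y).
  by rewrite [X in is_derive _ _ _ X]derive1E; exact: derivableP.
pose v y := h y / derive1 h y.
have dv y : is_derive y (1 : R) v (1 - m).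
  have := is_derive_mul (dh y) (is_deriveV (h'0 y) (dh' y)).
  congr (is_derive _ _ _ _).
  rewrite -[_ *: _]/(_ * _); move: (H y) (h'0 y).
  move: (h y) (derive1 h y) (derive1 (derive1 h) y) => x x' x'' E x'0.
  have -> : m = x * x'' / x' ^+ 2 by rewrite E mulfK// expf_neq0.
  by field.
have vE y : v y = v 0 + (1 - m) * y.
  have d0 z : is_derive z (1 : R) (fun z => v z + - (1 - m) * z) 0.
    have := is_derive_add (dv z) (is_derive_scale (- (1 - m)) (is_derive_id z (1 : R))).
    by rewrite mulr1 subrr.
  have := is_derive_0_is_cst y 0 d0; rewrite mulr0 addr0 => <-; ring.
have m1 : m = 1.
  apply/eqP/negPn/negP => m1; have m1' : 1 - m != 0 by rewrite subr_eq0 eq_sym.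
  (* The zero that the affine function [v] would have if its slope 1 - m were nonzero. *)
  have := vE (- v 0 / (1 - m)); rewrite (mulrC (1 - m)) divfK// addrN => /eqP.
  by rewrite /v mulf_eq0 invr_eq0 (negbTE (h0 _)) (negbTE (h'0 _)).
pose l := (v 0)^-1.
have v0 : v 0 != 0 by rewrite /v mulf_neq0 ?invr_neq0.
have hl y : derive1 h y = l * h y.
  have := vE y; rewrite m1 subrr mul0r addr0 /l => <-.
  by rewrite /v invf_div divfK.
exists (h 0), l => y.
have d0 z : is_derive z (1 : R) (fun z => h z * expR (- l * z)) 0.
  have de := is_derive1_comp (is_derive_expR (- l * z)) (is_derive_scale (- l) (is_derive_id z (1 : R))).
  have := is_derive_mul (dh z) de.
  congr (is_derive _ _ _ _); rewrite hl /=; ring.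
have := is_derive_0_is_cst y 0 d0; rewrite mulr0 expR0 mulr1 => <-.
by rewrite mulNr expRN mulfVK// gt_eqF// expR_gt0.
Qed.

(** At x = 0 the equation reads h(y) = K h(e + d y); differentiating it scales h, h', h'' by K, K d,
    K d^2. Since any point reaches any other, a single nonzero value of h or of h' excludes zeros
    everywhere, and h h'' / h'^2, in which K^2 d^2 cancels, is constant. *)
Lemma exp_of_homothety_transitive (R : realType) (h : R -> R) (y0 : R) :
  (forall y, derivable h y 1) -> (forall y, derivable (derive1 h) y 1) -> h y0 != 0 ->
  (forall y1 y2, exists K c d e : R,
    e + d * y1 = y2 /\ forall x y, h y = K * h (e + (c * x + d * y))) ->
  exists a lambda : R, forall y, h y = a * expR (lambda * y).
Proof.
move=> hd h'd hy0 H.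
have cst : (forall y, h y = h 0) -> exists a lambda : R, forall y, h y = a * expR (lambda * y).
  by move=> hc; exists (h 0), 0 => y; rewrite mul0r expR0 mulr1.
have [h'z|] := pselect (forall y, derive1 h y = 0).
  apply: cst => y; apply: is_derive_0_is_cst => z.
  by rewrite -(h'z z) derive1E; exact: derivableP.
move=> /existsNP[z0 /eqP h'z0].
have K1 y1 y2 : exists K d : R, [/\ h y1 = K * h y2, derive1 h y1 = K * d * derive1 h y2 &
    derive1 (derive1 h) y1 = K * d * d * derive1 (derive1 h) y2].
  have [K [c [d [e [<- Hh]]]]] := H y1 y2.
  have aff z : is_derive z (1 : R) (fun z => e + d * z) d.
    have := is_derive_add (is_derive_cst e z (1 : R)) (is_derive_scale d (is_derive_id z (1 : R))).
    by rewrite add0r mulr1.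
  have step (g g1 : R -> R) (k : R) : (forall y, derivable g y 1) ->
      (forall y, g1 y = k * g (e + d * y)) ->
      forall y, derive1 g1 y = k * d * derive1 g (e + d * y).
    move=> gd gE z; rewrite (_ : g1 = fun z => k * g (e + d * z)); last exact/funext.
    have /derivableP := gd (e + d * z); rewrite -derive1E => gd'.
    have := is_derive_scale k (@is_derive1_comp R g (fun z => e + d * z) z _ _ gd' (aff z)).
    move=> /@derive_val; rewrite -derive1E => ->; ring.
  have h1 := step h h K hd (fun y => etrans (Hh 0 y) _).
  have {}h1 : forall y, derive1 h y = K * d * derive1 h (e + d * y).
    by apply: h1 => y; rewrite mulr0 add0r.
  have h2 := step _ _ _ h'd h1.
  exists K, d; split; [|exact: h1|exact: h2].
  by rewrite (Hh 0 y1) mulr0 add0r.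
have h0 y : h y != 0.
  by apply/eqP => hy; have [K [d [E _ _]]] := K1 y0 y; move: hy0; rewrite E hy mulr0 eqxx.
have h'0 y : derive1 h y != 0.
  by apply/eqP => hy; have [K [d [_ E _]]] := K1 z0 y; move: h'z0; rewrite E hy mulr0 eqxx.
(* [m] is the value at 0 of the invariant quotient h h'' / h'^2. *)
apply: (exp_of_mul_derive2 (m := h 0 * derive1 (derive1 h) 0 / derive1 h 0 ^+ 2)) => // y.
have [K [d [-> -> ->]]] := K1 y 0.
by field; rewrite h'0.
Qed.

(** * Explicit isometries when f'' is exponential *)

Lemma of_class_addr (R : realType) (n k : nat) (h : 'rV[R]_n -> R) (c : R) :
  of_class k h -> of_class k (fun p => h p + c).
Proof. by move=> hk; exact: (@of_classD R n _ k h (fun=> c) hk (@of_class_cst R n _ k c)). Qed.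

Lemma smooth_row4 (R : realType) (n : nat) (X Y Z W : 'rV[R]_n -> R) :
  smooth X -> smooth Y -> smooth Z -> smooth W ->
  smooth (fun p => X p *: delta_mx 0 0 + Y p *: delta_mx 0 1
    + Z p *: delta_mx 0 2 + W p *: delta_mx 0 3 : 'rV[R]_4).
Proof.
move=> sX sY sZ sW k.
exact: (of_classD (of_classD (of_classD (of_classZl _ (sX k)) (of_classZl _ (sY k)))
  (of_classZl _ (sZ k))) (of_classZl _ (sW k))).
Qed.

Lemma row4_eq (R : realType) (u v : 'rV[R]_4) :
  u 0 0 = v 0 0 -> u 0 1 = v 0 1 -> u 0 2 = v 0 2 -> u 0 3 = v 0 3 -> u = v.
Proof.
move=> e0 e1 e2 e3; apply/rowP; case=> [[|[|[|[|i]]]] Hi] //.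
- by rewrite (_ : Ordinal Hi = 0)//; exact/val_inj.
- by rewrite (_ : Ordinal Hi = 1)//; exact/val_inj.
- by rewrite (_ : Ordinal Hi = 2)//; exact/val_inj.
- by rewrite (_ : Ordinal Hi = 3)//; exact/val_inj.
Qed.

(** With X = mu x and Y = y + s, the dx^2 term of the pullback is off by -2 (b y + c) dx^2. The
    quadratic terms compensate: mu dZ contributes c dx + b (x dy + y dx) and dW contributes -b x dx,
    so 2 mu dx dZ + 2 dy dW gains 2 (b y + c) dx^2 while the dx dy terms cancel. *)
Lemma metric_f_isometry (R : realType) (f : R -> R) (mu s b c : R) (t : 'rV[R]_4) :
  mu != 0 -> (forall y, f (y + s) * mu ^+ 2 = f y + (b * y + c)) ->
  exists2 phi, is_isometry (metric_f f) phi &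
    forall p, phi p = (mu * p 0 0 + t 0 0) *: delta_mx 0 0
      + (p 0 1 + s) *: delta_mx 0 1
      + (mu^-1 * (p 0 2 + c * p 0 0 + b * (p 0 0 * p 0 1)) + t 0 2) *: delta_mx 0 2
      + (p 0 3 - b / 2 * (p 0 0 * p 0 0) + t 0 3) *: delta_mx 0 3.
Proof.
move=> mu0 fE.
pose X (p : 'rV[R]_4) := mu * p 0 0 + t 0 0.
pose Y (p : 'rV[R]_4) := p 0 1 + s.
pose Z (p : 'rV[R]_4) := mu^-1 * (p 0 2 + c * p 0 0 + b * (p 0 0 * p 0 1)) + t 0 2.
pose W (p : 'rV[R]_4) := p 0 3 - b / 2 * (p 0 0 * p 0 0) + t 0 3.
pose phi p : 'rV[R]_4 := X p *: delta_mx 0 0 + Y p *: delta_mx 0 1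
    + Z p *: delta_mx 0 2 + W p *: delta_mx 0 3.
(* The inverse map: X' and Y' come from the affine components, after which Z' and W' follow by
   substitution. *)
pose X' (p : 'rV[R]_4) := mu^-1 * (p 0 0 + - t 0 0).
pose Y' (p : 'rV[R]_4) := p 0 1 + - s.
pose Z' (p : 'rV[R]_4) := mu * (p 0 2 + - t 0 2) + - c * X' p + - b * (X' p * Y' p).
pose W' (p : 'rV[R]_4) := p 0 3 + - t 0 3 + b / 2 * (X' p * X' p).
pose psi p : 'rV[R]_4 := X' p *: delta_mx 0 0 + Y' p *: delta_mx 0 1
    + Z' p *: delta_mx 0 2 + W' p *: delta_mx 0 3.
have smZ (a : R) (h : 'rV[R]_4 -> R) : smooth h -> smooth (fun p => a * h p).
  by move=> hs k; exact: (@of_classM R 4 k (fun=> a) h (@of_class_cst R 4 _ k a) (hs k)).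
have smD (g h : 'rV[R]_4 -> R) : smooth g -> smooth h -> smooth (fun p => g p + h p).
  by move=> gs hs k; exact: of_classD.
have smM (g h : 'rV[R]_4 -> R) : smooth g -> smooth h -> smooth (fun p => g p * h p).
  by move=> gs hs k; exact: of_classM.
have smA (h : 'rV[R]_4 -> R) (a : R) : smooth h -> smooth (fun p => h p + a).
  by move=> hs k; exact: of_class_addr.
have smC (a : 'I_4) : smooth (fun p : 'rV[R]_4 => p 0 a) by move=> k; exact: of_class_coord.
have sX' : smooth X' by apply: (smZ); exact: (smA).
have sY' : smooth Y' by exact: (smA).
have phi0 p : phi p 0 0 = X p by rewrite /phi !mxE /=; ring.
have phi1 p : phi p 0 1 = Y p by rewrite /phi !mxE /=; ring.
have phi2 p : phi p 0 2 = Z p by rewrite /phi !mxE /=; ring.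
have phi3 p : phi p 0 3 = W p by rewrite /phi !mxE /=; ring.
have psi0 p : psi p 0 0 = X' p by rewrite /psi !mxE /=; ring.
have psi1 p : psi p 0 1 = Y' p by rewrite /psi !mxE /=; ring.
have psi2 p : psi p 0 2 = Z' p by rewrite /psi !mxE /=; ring.
have psi3 p : psi p 0 3 = W' p by rewrite /psi !mxE /=; ring.
have sphi : smooth phi.
  apply: smooth_row4.
  - by apply: (smA); exact: (smZ).
  - exact: (smA).
  - by apply: (smA); apply: (smZ); apply: (smD);
      [apply: (smD) => //; exact: (smZ)|apply: (smZ); exact: (smM)].
  - apply: (smA); rewrite (_ : (fun p => _) = fun p : 'rV[R]_4 => p 0 3 + - (b / 2) * (p 0 0 * p 0 0)).
      by apply: (smD) => //; apply: (smZ); exact: (smM).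
    by apply/funext => p; rewrite mulNr.
exists phi => //; split.
  split=> //; exists psi; split.
  - apply: smooth_row4 => //.
    + apply: (smD); last by apply: (smZ); exact: (smM).
      by apply: (smD); [apply: (smZ); exact: (smA)|exact: (smZ)].
    + by apply: (smD); [exact: (smA)|apply: (smZ); exact: (smM)].
  - move=> p; have eX : X' (phi p) = p 0 0 by rewrite /X' phi0 /X; field.
    have eY : Y' (phi p) = p 0 1 by rewrite /Y' phi1 /Y; ring.
    apply: row4_eq; rewrite ?psi0 ?psi1 ?psi2 ?psi3 //.
    + by rewrite /Z' eX eY phi2 /Z; field.
    + by rewrite /W' eX phi3 /W; field.
  - move=> p; apply: row4_eq; rewrite ?phi0 ?phi1 ?phi2 ?phi3.
    + by rewrite /X psi0 /X'; field.
    + by rewrite /Y psi1 /Y'; ring.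
    + by rewrite /Z psi0 psi1 psi2 /Z'; field.
    + by rewrite /W psi0 psi3 /W'; field.
move=> p u v; rewrite !metric_form_metric_f phi1.
have [dphi _] := sphi 1%N.
have dc (a : 'I_4) (h : 'rV[R]_4 -> R) (w : 'rV[R]_4) (dh : R) : (forall p, phi p 0 a = h p) ->
    is_derive p w h dh -> ('d phi p w : 'rV[R]_4) 0 a = dh.
  move=> hE hd; rewrite -deriveE// derive_mx ?mxE; last exact: diff_derivable.
  by rewrite (_ : (fun _ => _) = h); [exact: derive_val|exact/funext].
have dx (a : 'I_4) (w : 'rV[R]_4) := is_derive_coord a p w.
have dcst (w : 'rV[R]_4) (a : R) := is_derive_cst a p w.
have d0 w := dc 0 X w _ phi0 (is_derive_add (is_derive_scale mu (dx 0 w)) (dcst w (t 0 0))).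
have d1 w := dc 1 Y w _ phi1 (is_derive_add (dx 1 w) (dcst w s)).
have d2 w := dc 2 Z w _ phi2 (is_derive_add (is_derive_scale mu^-1 (is_derive_add
   (is_derive_add (dx 2 w) (is_derive_scale c (dx 0 w)))
   (is_derive_scale b (is_derive_mul (dx 0 w) (dx 1 w))))) (dcst w (t 0 2))).
have W_d w : is_derive p w W _ := is_derive_add (is_derive_add (dx 3 w)
  (is_deriveN (is_derive_scale (b / 2) (is_derive_mul (dx 0 w) (dx 0 w))))) (dcst w (t 0 3)).
have d3 w := dc 3 W w _ phi3 (W_d w).
rewrite !d0 !d1 !d2 !d3 /Y.
have -> : f (p 0 1 + s) = (f (p 0 1) + (b * p 0 1 + c)) / mu ^+ 2.
  by rewrite -fE mulfK// expf_neq0.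
by field.
Qed.

Lemma affine_of_derive2_eq0 (R : realType) (F F1 : R -> R) :
  (forall y, is_derive y (1 : R) F (F1 y)) -> (forall y, is_derive y (1 : R) F1 0) ->
  forall y, F y = F1 0 * y + F 0.
Proof.
move=> dF dF1 y.
have d0 z : is_derive z (1 : R) (fun z => F z + - F1 0 * z) 0.
  have := is_derive_add (dF z) (is_derive_scale (- F1 0) (is_derive_id z (1 : R))).
  by rewrite mulr1 (is_derive_0_is_cst z 0 dF1) subrr.
have := is_derive_0_is_cst y 0 d0; rewrite mulr0 addr0 => <-; ring.
Qed.

Lemma homogeneous_of_exp (R : realType) (f : R -> R) (a lambda : R) :
  (forall y, derivable f y 1) -> (forall y, derivable (derive1 f) y 1) ->
  (forall y, derive1 (derive1 f) y = a * expR (lambda * y)) ->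
  homogeneous_manifold (metric_f f).
Proof.
move=> fd fd' fE p q.
(* [s] is forced by the second coordinate. The half exponent makes mu^2 cancel the factor e^(lambda
   s) that the shift puts on f'', so mu^2 f(y + s) - f(y) has second derivative 0. *)
pose s := q 0 1 - p 0 1; pose mu := expR (- (lambda * s) / 2).
have mu0 : mu != 0 by rewrite gt_eqF// expR_gt0.
have mu2 : mu ^+ 2 = expR (- (lambda * s)).
  by rewrite expr2 -expRD; congr expR; field.
have shift_d (g : R -> R) y : (forall y, derivable g y 1) ->
    is_derive y (1 : R) (fun y => mu ^+ 2 * g (y + s) + - 1 * g y)
      (mu ^+ 2 * derive1 g (y + s) + - 1 * derive1 g y).
  move=> gd.
  have gd' z : is_derive z (1 : R) g (derive1 g z) by rewrite derive1E; exact: derivableP.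
  have ds := is_derive_add (is_derive_id y (1 : R)) (is_derive_cst s y (1 : R)).
  have := @is_derive1_comp R g (fun y => y + s) y _ _ (gd' (y + s)) ds.
  rewrite addr0 mulr1 => gs.
  exact: (is_derive_add (is_derive_scale (mu ^+ 2) gs) (is_derive_scale (- 1) (gd' y))).
have [b [c bc]] : exists b c, forall y, f (y + s) * mu ^+ 2 = f y + (b * y + c).
  have d1 y := shift_d f y fd.
  have d2 y : is_derive y (1 : R)
      (fun y => mu ^+ 2 * derive1 f (y + s) + - 1 * derive1 f y) 0.
    have := shift_d _ y fd'; rewrite !fE mu2.
    congr (is_derive _ _ _ _).
    have -> : expR (- (lambda * s)) * (a * expR (lambda * (y + s))) = a * expR (lambda * y).
      by rewrite mulrCA -expRD; congr (_ * expR _); ring.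
    by ring.
  have H := affine_of_derive2_eq0 d1 d2.
  exists (mu ^+ 2 * derive1 f (0 + s) + - 1 * derive1 f 0), (mu ^+ 2 * f (0 + s) + - 1 * f 0) => y.
  by have := H y; cbv beta => <-; ring.
(* The translation that corrects the three coordinates other than y, so that [p] goes to [q]. *)
pose t : 'rV[R]_4 := (q 0 0 - mu * p 0 0) *: delta_mx 0 0
  + (q 0 2 - mu^-1 * (p 0 2 + c * p 0 0 + b * (p 0 0 * p 0 1))) *: delta_mx 0 2
  + (q 0 3 - (p 0 3 - b / 2 * (p 0 0 * p 0 0))) *: delta_mx 0 3.
have [phi iso phiE] := metric_f_isometry t mu0 bc.
exists phi => //; rewrite phiE /t /s.
by apply: row4_eq; rewrite !mxE /=; ring.
Qed.

(** * Classification of the symmetric and homogeneous cases *)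

Lemma exp_of_homogeneous (R : realType) (f : R -> R) :
  (forall y, derivable f y 1) -> (forall y, derivable (derive1 f) y 1) ->
  (forall y, derivable (derive1 (derive1 f)) y 1) ->
  (forall y, derivable (derive1 (derive1 (derive1 f))) y 1) ->
  homogeneous_manifold (metric_f f) ->
  exists a lambda : R, forall y, derive1 (derive1 f) y = a * expR (lambda * y).
Proof.
move=> fd fd1 fd2 fd3 hom.
have [h0|/existsNP[y0 /eqP hy0]] := pselect (forall y, derive1 (derive1 f) y = 0).
  by exists 0, 0 => y; rewrite h0 mul0r.
apply: (exp_of_homothety_transitive fd2 fd3 hy0) => y1 y2.
(* Transitivity along the y axis is enough: there x = 0, so the image height is e + d y1. *)
have [phi iso phiE] := hom (y1 *: delta_mx 0 1) (y2 *: delta_mx 0 1).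
have [K [c [d [e H]]]] := hessian_functional_equation fd fd1 hy0 iso.
exists K, c, d, e; split.
  have [+ _] := H (y1 *: delta_mx 0 1); rewrite phiE !mxE /= => E.
  by rewrite -[RHS]mulr1 E; ring.
move=> x y; have [] := H (x *: delta_mx 0 0 + y *: delta_mx 0 1).
rewrite !mxE /= => E.
by rewrite E !(mulr0, mulr1, addr0, add0r).
Qed.

Theorem theorem1p4 (R : realType) (f : R -> R) (f_analytic : real_analytic f) :
  (symmetric_manifold (metric_f f) <-> (forall y : R, f^`(3) y = 0)) /\
  (homogeneous_manifold (metric_f f) <->
     exists a lambda : R, forall y : R, f^`(2) y = a * expR (lambda * y)).
Proof.
(* Analyticity is used through the derivability of f and of its first three derivatives. *)
have [fd f1] := real_analytic_derive f_analytic.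
have [fd1 f2] := real_analytic_derive f1.
have [fd2 f3] := real_analytic_derive f2.
have [fd3 _] := real_analytic_derive f3.
rewrite (derive1nS f 2) (derive1nS f 1) derive1n1.
split; first exact: (symmetric_metric_f fd fd1 fd2).
split; first exact: (exp_of_homogeneous fd fd1 fd2 fd3).
by move=> [a [lambda fE]]; exact: (homogeneous_of_exp fd fd1 fE).
Qed.
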